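(* The set of codes for Ramsey positive analytic subsets of $[\omega]^\omega$ is $\mathbf{\Sigma}^1_2$-complete. That is, if $A\subseteq 2^\omega\times[\omega]^\omega$ is a good universal $\mathbf{\Sigma}^1_1$ set, then $\{x\in 2^\omega:\ A_x \text{ is Ramsey positive}\}$ is a $\mathbf{\Sigma}^1_2$-complete subset of $2^\omega$.
   Context: $[\omega]^\omega$ is the set of infinite subsets of $\omega$, with the Polish topology induced from the Baire space $\omega^\omega$ by identifying an infinite set with its increasing enumeration (''standard topology''). $[\omega]^{<\omega}$ is the set of finite subsets of $\omega$. For $\sigma\in[\omega]^{<\omega}$ and $s\in[\omega]^\omega$ with $\max\sigma<\min s$ (no restriction if $\sigma=\emptyset$) put $[\sigma,s]=\{x\in[\omega]^\omega:\ \sigma\subseteq x\subseteq\sigma\cup s\}$ (so $\sigma$ is an initial segment of $x$ and the rest of $x$ is contained in $s$). A set $B\subseteq[\omega]^\omega$ is Ramsey null if for every such $[\sigma,s]$ there is an infinite $s'\subseteq s$ with $[\sigma,s']\cap B=\emptyset$; it is Ramsey positive if it is not Ramsey null. Analytic ($\mathbf{\Sigma}^1_1$) subsets of $[\omega]^\omega$ are coded by points of $2^\omega$ using a fixed good universal $\mathbf{\Sigma}^1_1$ set $A\subseteq 2^\omega\times[\omega]^\omega$: $A$ is $\mathbf{\Sigma}^1_1$, its sections $A_x=\{y:(x,y)\in A\}$ are exactly the $\mathbf{\Sigma}^1_1$ subsets of $[\omega]^\omega$, and (goodness) for every $\mathbf{\Sigma}^1_1$ set $B\subseteq 2^\omega\times[\omega]^\omega$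 there is a continuous $h:2^\omega\to 2^\omega$ with $B_z=A_{h(z)}$ for all $z$. (The standard universal sets are good.) A code for a set $B$ is an $x$ with $A_x=B$. A subset $P$ of a zero-dimensional Polish space $Y$ is $\mathbf{\Sigma}^1_2$-complete if $P$ is $\mathbf{\Sigma}^1_2$ and for every zero-dimensional Polish space $Z$ and every $\mathbf{\Sigma}^1_2$ set $P'\subseteq Z$ there is a continuous $f:Z\to Y$ with $f^{-1}(P)=P'$. *)

(* Defs.v *)
From HB Require Import structures.
From mathcomp Require Import all_boot all_order all_algebra finmap.
From mathcomp Require Import all_classical all_reals topology cantor.

Set Implicit Arguments.
Unset Strict Implicit.
Unset Printing Implicit Defensive.

Import Order.TTheory GRing.Theory Num.Theory.

Local Open Scope classical_set_scope.

Section Polish.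
Local Open Scope ring_scope.

Definition is_metric (R : realType) (T : Type) (d : T -> T -> R) : Prop :=
  [/\ forall x y, 0 <= d x y,
      forall x y, d x y = 0 <-> x = y,
      forall x y, d x y = d y x &
      forall x y z, d x z <= d x y + d y z].

Definition metric_compatible (R : realType) (T : topologicalType)
    (d : T -> T -> R) : Prop :=
  forall (x : T) (U : set T),
    nbhs x U <-> exists2 e : R, 0 < e & [set y | d x y < e] `<=` U.

Definition metric_complete (R : realType) (T : topologicalType)
    (d : T -> T -> R) : Prop :=
  forall u : nat -> T,
    (forall e : R, 0 < e -> exists N : nat, forall m n : nat,
        (N <= m)%N -> (N <= n)%N -> d (u m) (u n) < e) ->
    exists l : T, u @ \oo --> l.

Definition separable (T : topologicalType) : Prop :=
  exists2 D : set T, countable D & dense D.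

Definition polish (R : realType) (T : topologicalType) : Prop :=
  separable T /\
  exists d : T -> T -> R,
    [/\ is_metric d, metric_compatible d & metric_complete d].

(* Not [topology.zero_dimensional], which only asks that distinct points be
   separated by clopen sets; for non-compact Polish spaces that is weaker. *)
Definition has_clopen_basis (T : topologicalType) : Prop := basis (@clopen T).

End Polish.

Definition baire_space : topologicalType := prod_topology (fun _ : nat => nat).

(* Boldface pointclasses, as projections along the Baire space:
   Sigma^1_1 from closed sets, Sigma^1_2 from Pi^1_1 sets. *)
Definition Sigma11 (X : topologicalType) (P : set X) : Prop :=
  exists2 C : set (X * baire_space), closed C & P = fst @` C.

Definition Pi11 (X : topologicalType) (P : set X) : Prop := Sigma11 (~` P).

Definition Sigma12 (X : topologicalType) (P : set X) : Prop :=
  exists2 C : set (X * baire_space), Pi11 C & P = fst @` C.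

(* Meant for [Y] Polish with a clopen basis. The parameter [R] only serves to
   carry the metrics in [polish]. *)
Definition Sigma12_complete (R : realType) (Y : topologicalType)
    (P : set Y) : Prop :=
  Sigma12 P /\
  forall Z : topologicalType, polish R Z -> has_clopen_basis Z ->
  forall P' : set Z, Sigma12 P' ->
  exists2 f : Z -> Y, continuous f & f @^-1` P = P'.

Record infset : Type := InfSet {
  infset_val :> set nat ;
  infset_infinite : infinite_set infset_val }.

HB.instance Definition _ := gen_eqMixin infset.
HB.instance Definition _ := gen_choiceMixin infset.

Definition is_enumeration (s : set nat) (f : nat -> nat) : Prop :=
  {homo f : m n / (m < n)%N} /\ range f = s.

(* [is_enumeration s] has exactly one element when [s] is infinite, see
   [enumerationP] and [is_enumeration_inj]; the default value is never used. *)
Definition enumeration (s : infset) : baire_space :=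
  xget (fun=> 0%N) (is_enumeration s).

HB.instance Definition _ := Topological.copy infset (initial_topology enumeration).

Lemma is_enumeration_ex (s : infset) : exists f, is_enumeration s f.
Proof.
have next k : exists n, `[< infset_val s n /\ (k <= n)%N >].
  apply: contrapT => no; apply: (infset_infinite (i := s)).
  apply: (sub_finite_set _ (finite_II k)) => n sn /=.
  rewrite ltnNge; apply/negP => kn; apply: no; exists n; exact/asboolP.
pose nx k := ex_minn (next k).
have nxP k : [/\ infset_val s (nx k), (k <= nx k)%N &
    forall m, infset_val s m -> (k <= m)%N -> (nx k <= m)%N].
  rewrite /nx; case: ex_minnP => n /asboolP[sn kn] nmin; split=> // m sm km.
  by apply: nmin; exact/asboolP.
pose f n := iter n (fun k => nx k.+1) (nx 0%N).
have fS n : (f n < f n.+1)%N by have [] := nxP (f n).+1.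
have sf n : infset_val s (f n) by case: n => [|n]; [have [] := nxP 0%N | have [] := nxP (f n).+1].
have fge n : (n <= f n)%N by elim: n => // n IH; exact: leq_ltn_trans IH (fS n).
exists f; split.
  move=> m n; elim: n => // n IH; rewrite ltnS leq_eqVlt => /predU1P[->//|mn].
  exact: ltn_trans (IH mn) (fS n).
apply/seteqP; split=> [_ [n _ <-] //|k sk].
have kex : exists n, (k <= f n)%N by exists k.
case: (ex_minnP kex) => -[|n] kn nmin.
  by exists 0%N => //; apply/eqP; rewrite eqn_leq kn andbT; have [_ _ ->] := nxP 0%N.
exists n.+1 => //; apply/eqP; rewrite eqn_leq kn andbT.
have [_ _ -> //] := nxP (f n).+1; rewrite ltnNge; apply/negP => /nmin.
by rewrite ltnn.
Qed.

Lemma enumerationP (s : infset) : is_enumeration s (enumeration s).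
Proof. by have [f sf] := is_enumeration_ex s; exact: (xgetI _ sf). Qed.

Lemma is_enumeration_inj (s : set nat) (f g : nat -> nat) :
  is_enumeration s f -> is_enumeration s g -> f = g.
Proof.
suff le h k : is_enumeration s h -> is_enumeration s k ->
    forall n, (h n <= k n)%N.
  by move=> sf sg; apply/funext => n; apply/eqP; rewrite eqn_leq !le.
move=> [hmono hs] [kmono ks] n; elim/ltn_ind: n => n IH.
have [m _ hm] : range h (k n) by rewrite hs -ks; exists n.
rewrite -hm; case: (leqP n m) => [|mn].
  by rewrite leq_eqVlt => /predU1P[->//|/hmono/ltnW].
have := leq_ltn_trans (IH m mn) (kmono _ _ mn).
by rewrite hm ltnn.
Qed.

(* The set [sigma, s] *)
Definition ellentuck (sigma : {fset nat}) (s : infset) : set infset :=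
  [set x : infset | [set` sigma] `<=` x /\ x `<=` [set` sigma] `|` s].

Definition ramsey_null (B : set infset) : Prop :=
  forall (sigma : {fset nat}) (s : infset),
    (forall i j : nat, i \in sigma -> infset_val s j -> (i < j)%N) ->
    exists2 s' : infset, s' `<=` s & ellentuck sigma s' `&` B = set0.

Definition ramsey_positive (B : set infset) : Prop := ~ ramsey_null B.

Definition good_universal_Sigma11 (A : set (cantor_space * infset)) : Prop :=
  [/\ Sigma11 A,
      forall B : set infset, Sigma11 B <-> exists x, xsection A x = B &
      forall B : set (cantor_space * infset), Sigma11 B ->
        exists2 h : cantor_space -> cantor_space,
          continuous h & forall z, xsection B z = xsection A (h z)].

(* Main.v *)
Require Import Defs.
From mathcomp Require Import all_boot all_order all_algebra finmap.
From mathcomp Require Import all_classical all_reals topology cantor.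

Set Implicit Arguments.
Unset Strict Implicit.
Unset Printing Implicit Defensive.

Import Order.TTheory GRing.Theory Num.Theory.

Local Open Scope classical_set_scope.

(** Completeness of the set of codes has two halves of different nature.

    Upper bound.  Let C be closed with projection A.  Saying that a section A_x
    is Ramsey positive costs three quantifiers over reals when read literally,
    and the point is to replace it by the existence of a single real which
    certifies positivity and can be checked by a coanalytic condition.  Think
    of z as a proof that (x, Y) belongs to A, so that (x, Y, z) is in C.  If
    A_x meets [sigma, s'] for all infinite s' contained in s, then s can be
    thinned out so that every Y in [sigma, s] has such a proof, found step by
    step from initial segments of Y.  A combinatorial forcing decides each pair
    of a stem tau and a finite piece t of a proof: either every infinite subset
    of s provides an extension of tau which has a proof extending t, or s itself
    provides none.  Call the pair large in the first case.  Every member of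
    [tau, s] then has a longer stem that is large for an extension of t by one
    entry ([large_uniformize]); this rests on diagonalization ([fusion]) and on
    the Ramsey property of open sets ([open_ramsey]).  A certificate is a set s
    together with a relation L between stems and pieces of proofs having
    this extension property and such that each pair in L, cut down to finite
    precision, is met by C ([witness]).  Conversely, following L along any Y
    of [sigma, s] builds a proof that Y is in A_x, as C is closed
    ([witness_positive]).  Apart from one universal quantifier over reals, the
    definition of a certificate is arithmetical, whence [Sigma12_positive].

    Lower bound.  A Sigma^1_2 set over a zero-dimensional Polish space Z has
    the form: there is z such that no p satisfies D(a, z, p), with D closed;
    that is, the tree T(a, z) of attempts to build p is well founded.
    Well-foundedness is coanalytic, but the absence of branches dominated by a
    given y is, by [konig], a Borel property.  So let B_a consist of the sets Y
    all of whose elements code initial segments of one z, and such that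
    T(a, z) has no branch dominated by any shift of the enumeration of Y.  If
    T(a, z) is well founded, then all infinite sets of codes of initial segments
    of z are in B_a, which is therefore positive.  If every T(a, z) has a
    branch, then from any Y in B_a one can choose a subset sparse enough for
    its enumeration to dominate the branch of T(a, z), and then none of the
    infinite subsets of this set is in B_a, even after adding finitely many
    elements: hence B_a is null ([domination_set_positive]).  As B is analytic
    and depends on a only through a countable family of clopen sets
    ([polish_coordinates]), goodness of the universal set turns this into a
    continuous reduction. *)

(** * Increasing sequences, cylinders and infinite sets *)

Definition increasing (y : nat -> nat) : Prop := {homo y : m n / (m < n)%N}.

Lemma increasing_ge (y : nat -> nat) : increasing y -> forall n, (n <= y n)%N.
Proof.
by move=> yi; elim=> // n IH; exact: leq_ltn_trans IH (yi _ _ (ltnSn n)).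
Qed.

Lemma increasingS (y : nat -> nat) :
  (forall n, (y n < y n.+1)%N) -> increasing y.
Proof.
move=> yS m n; elim: n => // n IH; rewrite ltnS leq_eqVlt => /predU1P[->//|mn].
exact: ltn_trans (IH mn) (yS n).
Qed.

(** The Ellentuck neighbourhood [tau, s], seen through enumerations.  Monotony
    of y makes the elements of s below max tau harmless, so that s need not lie
    above tau. *)
Definition cylinder (tau : seq nat) (s : set nat) : set (nat -> nat) :=
  [set y | [/\ increasing y, mkseq y (size tau) = tau &
               forall i, (size tau <= i)%N -> s (y i)]].

(** Inclusion of s' in s, disregarding what is not above tau: the part which
    determines the cylinders with stem tau. *)
Definition beyond (tau : seq nat) (s' s : set nat) : Prop :=
  forall j, s' j -> all (fun i => i < j)%N tau -> s j.

Lemma beyond_subset tau s' s : s' `<=` s -> beyond tau s' s.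
Proof. by move=> ss j /ss. Qed.

Lemma cylinder_beyond tau s' s :
  beyond tau s' s -> cylinder tau s' `<=` cylinder tau s.
Proof.
move=> ss y [yi yt ys]; split=> // i ti; apply: (ss _ (ys i ti)).
rewrite -yt; apply/allP => _ /mapP[k + ->]; rewrite mem_iota => kt.
by apply: yi; exact: leq_trans ti.
Qed.

Lemma cylinder_subset tau s' s :
  s' `<=` s -> cylinder tau s' `<=` cylinder tau s.
Proof. by move=> ss; apply: cylinder_beyond; exact: beyond_subset. Qed.

Lemma mkseq_sorted (y : nat -> nat) n : increasing y -> sorted ltn (mkseq y n).
Proof.
move=> yi; apply: (homo_sorted (e := ltn)) (iota_ltn_sorted 0 n) => i j.
exact: yi.
Qed.

Lemma cylinder_mkseq tau s y m : cylinder tau s y -> (size tau <= m)%N ->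
  cylinder (mkseq y m) s y.
Proof.
move=> [yi yt ys] tm; split=> //; first by rewrite size_mkseq.
by move=> i; rewrite size_mkseq => mi; apply: ys; exact: leq_trans mi.
Qed.

Lemma mkseq_eqP (T : eqType) (y z : nat -> T) m :
  mkseq y m = mkseq z m <-> (forall i, (i < m)%N -> y i = z i).
Proof.
split=> [yz i im|yz]; first by rewrite -(nth_mkseq (y i) y im) yz nth_mkseq.
by apply/eq_in_map => i; rewrite mem_iota => /yz.
Qed.

Lemma take_mkseq (T : Type) (y : nat -> T) m n : (n <= m)%N ->
  take n (mkseq y m) = mkseq y n.
Proof. by move=> nm; rewrite -map_take take_iota (minn_idPl nm). Qed.

Lemma cylinder_head tau s y : cylinder tau s y ->
  cylinder (rcons tau (y (size tau))) s y.
Proof.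
move=> cy; have := cylinder_mkseq cy (leqnSn _).
by case: cy => _ yt _; rewrite mkseqS yt.
Qed.

(** The stems that a fusion below sg controls.  The last entry of tau has to
    be in s, since it tells up to which stage of the construction of s the
    stem tau was known. *)
Definition stem_over (sg : seq nat) (s : set nat) (tau : seq nat) : Prop :=
  tau = sg \/ [/\ tau <> [::], sorted ltn tau & s (last 0%N tau)].

Lemma stem_over_mkseq sg s tau y m : stem_over sg s tau -> cylinder tau s y ->
  (size tau <= m)%N -> stem_over sg s (mkseq y m).
Proof.
move=> st [yi yt ys]; rewrite leq_eqVlt => /predU1P[<-|]; first by rewrite yt.
case: m => // m tm; right; split; [by []|exact: mkseq_sorted|].
by rewrite mkseqS last_rcons; exact: ys.
Qed.

Lemma infinite_above (s : set nat) n :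
  infinite_set s -> infinite_set (s `&` [set j | (n < j)%N]).
Proof.
move=> si sf; apply: si.
apply: (sub_finite_set (B := (s `&` [set j | (n < j)%N]) `|` `I_n.+1)).
  by move=> j sj /=; case: (ltnP n j) => nj; [left|right].
by rewrite finite_setU; split=> //; exact: finite_II.
Qed.

Lemma infinite_ex (s : set nat) n :
  infinite_set s -> exists2 j, s j & (n < j)%N.
Proof.
move=> /(infinite_above (n := n)) si; apply: contrapT => no.
apply: si; rewrite (_ : _ `&` _ = set0); first exact: finite_set0.
by apply/seteqP; split=> // j [sj nj]; apply: no; exists j.
Qed.

Lemma unbounded_infinite (s : set nat) :
  (forall n, exists2 j, s j & (n < j)%N) -> infinite_set s.
Proof.
move=> ub /finite_seqP[l sl]; have [j] := ub (\max_(i <- l) i)%N.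
rewrite sl /= => jl; rewrite ltnNge => /negP; apply.
exact: (@leq_bigmax_seq _ _ predT id).
Qed.

Lemma all_lt_bigmax (tau : seq nat) j :
  (\max_(i <- tau) i < j)%N -> all (fun i => i < j)%N tau.
Proof.
move=> mj; apply/allP => i it; apply: leq_ltn_trans mj.
exact: (@leq_bigmax_seq _ _ predT id).
Qed.

Lemma range_infinite (y : nat -> nat) : increasing y -> infinite_set (range y).
Proof.
move=> yi; apply: unbounded_infinite => n; exists (y n.+1); first by exists n.+1.
exact: increasing_ge.
Qed.

(** * Fusion and the Ramsey property of open sets *)

Fixpoint sorted_below (n : nat) : seq (seq nat) :=
  if n is n'.+1 then sorted_below n' ++ map (rcons^~ n') (sorted_below n')
  else [:: [::]].

Lemma sorted_rcons_ltn tau a :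
  sorted ltn (rcons tau a) = all (fun i => i < a)%N tau && sorted ltn tau.
Proof. by rewrite !(sorted_pairwise ltn_trans) pairwise_rcons. Qed.

Lemma mem_sorted_below n tau : sorted ltn tau -> all (fun i => i < n)%N tau ->
  tau \in sorted_below n.
Proof.
elim: n tau => [|n IH] tau; first by case: tau.
case/lastP: tau => [|tau a].
  by move=> _ _; rewrite mem_cat IH.
rewrite sorted_rcons_ltn all_rcons => /andP[ta st] /andP[an _].
rewrite /= mem_cat; move: an; rewrite ltnS leq_eqVlt => /predU1P[an|an].
  by subst n; rewrite (map_f (rcons^~ a)) ?orbT // IH.
rewrite IH ?sorted_rcons_ltn ?ta // all_rcons an /=.
by apply: sub_all ta => i /= ia; exact: ltn_trans an.
Qed.

Lemma dense_seq (T : eqType) (Q : T -> set nat -> Prop) (s0 : set nat) (l : seq T) :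
  (forall x s s', Q x s -> s' `<=` s -> Q x s') ->
  (forall x s, x \in l -> s `<=` s0 -> infinite_set s ->
     exists s', [/\ s' `<=` s, infinite_set s' & Q x s']) ->
  forall s, s `<=` s0 -> infinite_set s ->
  exists s', [/\ s' `<=` s, infinite_set s' & forall x, x \in l -> Q x s'].
Proof.
move=> her; elim: l => [|x l IH] dens s ss0 si; first by exists s; split.
have [s1 [s1s s1i Qx]] := dens x s (mem_head _ _) ss0 si.
have [|s2 [s21 s2i Ql]] := IH _ s1 (subset_trans s1s ss0) s1i.
  by move=> y t yl; apply: dens; rewrite inE yl orbT.
exists s2; split=> //; first exact: subset_trans s1s.
by move=> y; rewrite inE => /predU1P[->|/Ql //]; exact: her Qx s21.
Qed.

(** Diagonalization.  The set s' is built by choosing its elements n_0 < n_1 <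
    ... one after the other, keeping a reservoir for the later ones; once n_k is
    chosen, the reservoir is thinned out so that P holds for the finitely many
    increasing stems with entries up to n_k.  For a stem ending in n_k this
    handles all of s' above it, and the first hypothesis says that nothing else
    matters. *)
Lemma fusion (sg : seq nat) (s0 : set nat) (P : seq nat -> set nat -> Prop) :
  (forall tau s s', P tau s -> beyond tau s' s -> P tau s') ->
  (forall tau s, stem_over sg s0 tau -> s `<=` s0 -> infinite_set s ->
     exists s', [/\ s' `<=` s, infinite_set s' & P tau s']) ->
  infinite_set s0 ->
  exists s', [/\ s' `<=` s0, infinite_set s' &
                 forall tau, stem_over sg s' tau -> P tau s'].
Proof.
move=> her dens s0i.
have [s1 [s10 s1i Psg]] := dens sg s0 (or_introl erefl) (@subset_refl _ _) s0i.
(* A state is a pair of the last chosen element and the current reservoir; the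
   element 0 of the initial state is a dummy. *)
pose valid (a : nat * set nat) := infinite_set a.2 /\ a.2 `<=` s0.
pose step (a b : nat * set nat) := valid a -> [/\ valid b,
  a.2 b.1, b.2 `<=` a.2, forall j, b.2 j -> (b.1 < j)%N &
  forall tau, sorted ltn tau -> all (fun i => i < b.1.+1)%N tau ->
    stem_over sg s0 tau -> P tau b.2].
have ex_step a : {b | step a b}.
  apply: cid; have [[ai a0]|no] := pselect (valid a); last by exists a.
  have [n an _] := infinite_ex 0 ai.
  have a'0 : a.2 `&` [set j | (n < j)%N] `<=` s0 by move=> j [/a0].
  have [||s' [s'a s'i Ps']] := @dense_seq _
      (fun tau s => stem_over sg s0 tau -> P tau s) s0 (sorted_below n.+1) _ _
      _ a'0 (infinite_above (n := n) ai).
  - by move=> tau s s' Ps ss st; apply: her (Ps st) _; exact: beyond_subset.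
  - move=> tau s _ ss0 si; have [st|no] := pselect (stem_over sg s0 tau).
      by have [s' [? ? ?]] := dens tau s st ss0 si; exists s'; split.
    by exists s; split.
  exists (n, s') => _; split=> //=.
  - by split=> // j /s'a[/a0].
  - by move=> j /s'a[].
  - by move=> j /s'a[].
  - by move=> tau st ta; apply: Ps'; exact: mem_sorted_below.
have [f [f0 fstep]] := dependent_choice ex_step (0, s1)%N.
have fv k : valid (f k).
  by elim: k => [|k IH]; [rewrite f0 | have [] := fstep k IH].
pose n k := (f k.+1).1.
have fmono j k : (j <= k)%N -> (f k).2 `<=` (f j).2.
  elim: k => [|k IH]; first by rewrite leqn0 => /eqP->.
  rewrite leq_eqVlt => /predU1P[->//|jk]; apply: subset_trans (IH jk).
  by have [] := fstep k (fv k).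
have nf k j : (j <= k)%N -> (f j).2 (n k).
  by move=> jk; have [_ + _ _ _] := fstep k (fv k); exact: fmono.
have n_incr : increasing n.
  apply: increasingS => k; have [_ _ _ + _] := fstep k (fv k); apply.
  exact: nf.
have ns1 k : s1 (n k) by have := nf k 0 (leq0n _); rewrite f0.
have f1s : range n `<=` s1 by move=> _ [k _ <-].
exists (range n); split.
- exact: subset_trans s10.
- exact: range_infinite.
move=> tau [->|[tau0 st [k _ kt]]]; first by apply: her Psg _; exact: beyond_subset.
have [_ _ _ _ +] := fstep k (fv k).
case/lastP: tau tau0 st kt => // tau a _ st; rewrite last_rcons => kt.
move: (st); rewrite sorted_rcons_ltn => /andP[ta _].
have sta : stem_over sg s0 (rcons tau a).
  right; split=> //; first by case: (tau).
  by rewrite last_rcons -kt; apply/s10/ns1.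
move=> /(_ (rcons tau a)) Pf.
have {}Pf : P (rcons tau a) (f k.+1).2.
  apply: Pf => //; rewrite all_rcons -/(n k) kt ltnSn /=.
  by apply: sub_all ta => i /= /ltnW; rewrite -ltnS.
apply: her Pf _ => _ [j _ <-]; rewrite all_rcons -kt => /andP[kj _].
apply: nf; rewrite ltnNge; apply/negP; rewrite leq_eqVlt => /predU1P[jk|/n_incr jk].
  by rewrite jk ltnn in kj.
by have := ltn_trans kj jk; rewrite ltnn.
Qed.

Definition hits (sg : seq nat) (F : set (seq nat)) (y : nat -> nat) : Prop :=
  exists2 m, (size sg <= m)%N & F (mkseq y m).

(** Galvin-Prikry for open sets.  A stem is accepted by s if its cylinder is
    contained in the open set, and rejected if no infinite subset of s accepts
    it.  After a fusion, s accepts or rejects every stem that matters.  If it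
    rejects sg, a second fusion makes rejection pass from a stem to its
    one-point extensions: infinitely many accepted extensions would form a
    subset accepting the stem.  Then all stems are rejected, so none can belong
    to F. *)
Lemma open_ramsey (sg : seq nat) (F : set (seq nat)) (s : set nat) :
  infinite_set s ->
  exists s', [/\ s' `<=` s, infinite_set s' &
    (forall y, cylinder sg s' y -> hits sg F y) \/
    (forall y, cylinder sg s' y -> ~ hits sg F y)].
Proof.
move=> si.
(* Acceptance refers to sg and not to tau: the hit may occur at a stem shorter
   than tau. *)
pose acc tau s := forall y, cylinder tau s y -> hits sg F y.
pose rej tau s := forall s', beyond tau s' s -> infinite_set s' -> ~ acc tau s'.
have acc_her tau s1 s2 : acc tau s1 -> beyond tau s2 s1 -> acc tau s2.
  by move=> a b y /(cylinder_beyond b) /a.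
have rej_her tau s1 s2 : rej tau s1 -> beyond tau s2 s1 -> rej tau s2.
  move=> r b s3 b3; apply: r => j s3j tj; apply: b => //.
  exact: b3.
have [] := @fusion sg s (fun tau s => acc tau s \/ rej tau s) _ _ si.
- by move=> tau s1 s2 [a|r] b; [left; exact: acc_her b|right; exact: rej_her b].
- move=> tau s1 _ _ s1i; have [r|] := pselect (rej tau s1).
    by exists s1; split=> //; right.
  move=> /existsNP[s2] /not_implyP[b /not_implyP[s2i /contrapT a]].
  have nf := infinite_above (n := \max_(i <- tau) i) s2i.
  exists (s2 `&` [set j | (\max_(i <- tau) i < j)%N]); split => //.
    by move=> j [s2j /= mj]; apply: b => //; exact: all_lt_bigmax.
  by left; apply: acc_her a _ => j [].
move=> s1 [s1s s1i dec].
have [a|r] : acc sg s1 \/ rej sg s1 by apply: dec; left.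
  by exists s1; split=> //; left.
have [] := @fusion sg s1 (fun tau s => rej tau s1 -> forall a, s a ->
  sorted ltn (rcons tau a) -> rej (rcons tau a) s1) _ _ s1i.
- move=> tau s2 s3 h b /h{}h a s3a st; apply: h => //; apply: b => //.
  by move: st; rewrite sorted_rcons_ltn => /andP[].
- move=> tau s2 st s21 s2i.
  have [rt|?] := pselect (rej tau s1); last by exists s2; split.
  pose S := s2 `&` [set a | acc (rcons tau a) s1].
  have Sfin : finite_set S.
    apply: contrapT => Si; apply: (rt S _ Si).
      by apply: beyond_subset => j [/s21].
    move=> y cy; have [_ ays] : S (y (size tau)) by case: cy => _ _; apply.
    apply: ays; apply: cylinder_head; apply: cylinder_subset cy.
    by move=> j [/s21].
  exists (s2 `\` S); split; [by move=> j []|exact: infinite_setD|].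
  move=> _ a [s2a nSa] sta; have [] := dec (rcons tau a) => //.
    by right; rewrite last_rcons; split=> //; [case: (tau)|exact: s21].
  by move=> aa; case: nSa.
move=> s2 [s21 s2i rejS]; exists s2; split=> //; first exact: subset_trans s1s.
right => y cy [m sgm Fm].
have rm : rej (mkseq y m) s1.
  have ysg : mkseq y (size sg) = sg by case: cy.
  elim: m sgm {Fm} => [|m IH].
    by rewrite leqn0 => /eqP s0; rewrite -s0 ysg.
  rewrite leq_eqVlt => /predU1P[<-|]; first by rewrite ysg.
  rewrite ltnS => sgm.
  rewrite mkseqS; apply: rejS.
  - by apply: stem_over_mkseq cy sgm; left.
  - exact: IH.
  - by case: cy => _ _; apply.
  - by rewrite -mkseqS; apply: mkseq_sorted; case: cy.
apply: (rm s1) => // z [_ zy _]; exists m => //.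
by rewrite size_mkseq in zy; rewrite zy.
Qed.

(** * Uniformization on a cylinder *)

(** Reading U t y as: y has a proof of membership beginning with t, the pair
    (tau, t) is large when no thinning of s destroys all extensions of tau that
    have a proof beginning with t. *)
Definition large (U : seq nat -> set (nat -> nat)) (s : set nat)
    (tau t : seq nat) : Prop :=
  forall s', s' `<=` s -> infinite_set s' -> exists2 y, cylinder tau s' y & U t y.

(** Bounding the code of t also bounds its length, which makes one bound serve
    both for limiting each fusion stage to finitely many t and for making
    stems grow with t. *)
Lemma size_code (t : seq nat) : (size t <= CodeSeq.code t)%N.
Proof.
elim: t => //= n t IH; apply: leq_ltn_trans IH _.
rewrite -[X in (X < _)%N]mul1n; apply: (@leq_trans (CodeSeq.code t).*2.+1).
  by rewrite mul1n ltnS -addnn leq_addr.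
by rewrite leq_pmull // expn_gt0.
Qed.

(** After a first fusion, largeness of (tau, t) is decided whenever the code of
    t is at most the length of tau, in the sense that otherwise no member of
    the cylinder has a proof beginning with t.  If (tau, t) is large, consider
    the open set of the y which reach a large pair (tau', t n).  Its complement
    contains no [tau, s'] : some y there would have a proof beginning with
    some t n, and a stem of y long enough to be decided for t n would have to
    be large.  By [open_ramsey] a thinner set thus has its cylinder inside the
    open set, and a second fusion achieves this for all large pairs at once;
    L is the relation of being a large, decided pair. *)
Lemma large_uniformize (U : seq nat -> set (nat -> nat)) (sg : seq nat) (s : set nat) :
  (forall t y, U t y -> exists n, U (rcons t n) y) ->
  infinite_set s -> large U s sg [::] ->
  exists (s' : set nat) (L : seq nat -> seq nat -> Prop),
  [/\ s' `<=` s /\ infinite_set s', L sg [::],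
      forall tau t, L tau t -> exists2 y, cylinder tau s' y & U t y &
      forall tau t y, L tau t -> cylinder tau s' y ->
        exists m n, [/\ (size tau <= m)%N, (size t < m)%N &
                        L (mkseq y m) (rcons t n)]].
Proof.
move=> Usplit si lsg.
pose rej s tau t := forall y, cylinder tau s y -> ~ U t y.
have large_her tau t s1 s2 : large U s1 tau t -> beyond tau s2 s1 -> large U s2 tau t.
  move=> l b s3 s32 s3i.
  have [] := l (s3 `&` [set j | (\max_(i <- tau) i < j)%N]).
  - by move=> j [/s32 /b s1j mj]; apply: s1j; exact: all_lt_bigmax.
  - exact: infinite_above.
  by move=> y cy Uy; exists y => //; apply: cylinder_subset cy => j [].
have rej_her tau t s1 s2 : rej s1 tau t -> beyond tau s2 s1 -> rej s2 tau t.
  by move=> r b y /(cylinder_beyond b) /r.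
pose dec tau s i := large U s tau (CodeSeq.decode i) \/ rej s tau (CodeSeq.decode i).
have dec_her tau i s1 s2 : dec tau s1 i -> beyond tau s2 s1 -> dec tau s2 i.
  by move=> [l|r] b; [left; exact: large_her b|right; exact: rej_her b].
have [] := @fusion sg s
    (fun tau s => forall i, i \in iota 0 (size tau).+1 -> dec tau s i) _ _ si.
- by move=> tau s1 s2 h b i /h d; exact: dec_her d b.
- move=> tau s1 _ _ s1i.
  apply: (@dense_seq _ (fun i s => dec tau s i) s1) => //.
    by move=> i s2 s3 d ss; apply: dec_her d _; exact: beyond_subset.
  move=> i s2 _ s21 s2i.
  have [l|] := pselect (large U s2 tau (CodeSeq.decode i)).
    by exists s2; split=> //; left.
  move=> /existsNP[s3 /not_implyP[s32 /not_implyP[s3i no]]].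
  by exists s3; split=> //; right => y cy Uy; apply: no; exists y.
move=> s1 [s1s s1i decs1].
have {}decs1 tau t : stem_over sg s1 tau -> (CodeSeq.code t <= size tau)%N ->
    large U s1 tau t \/ rej s1 tau t.
  by move=> st tt; rewrite -[t]CodeSeq.codeK; apply: decs1; rewrite // mem_iota.
pose good m tau t := (CodeSeq.code t <= m)%N /\ large U s1 tau t.
pose F t : set (seq nat) := fun tau => exists n, good (size tau) tau (rcons t n).
have F_dense tau t s2 : stem_over sg s1 tau -> large U s1 tau t ->
    s2 `<=` s1 -> infinite_set s2 ->
    exists s3, [/\ s3 `<=` s2, infinite_set s3 &
      forall y, cylinder tau s3 y -> hits tau (F t) y].
  move=> st l s21 s2i.
  have [s3 [s32 s3i [h|h]]] := @open_ramsey tau (F t) s2 s2i.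
    by exists s3.
  have s31 := subset_trans s32 s21.
  have [y cy Uy] := l s3 s31 s3i; have [n Un] := Usplit _ _ Uy.
  have c1 := cylinder_subset s31 cy.
  exfalso; apply: (h y cy); exists (maxn (size tau) (CodeSeq.code (rcons t n))).
    exact: leq_maxl.
  exists n; rewrite /good size_mkseq leq_maxr; split=> //.
  have [||//|r] := decs1 (mkseq y (maxn (size tau) (CodeSeq.code (rcons t n)))) (rcons t n).
  - by apply: stem_over_mkseq c1 _ => //; exact: leq_maxl.
  - by rewrite size_mkseq leq_maxr.
  - by case: (r y) => //; apply: cylinder_mkseq c1 _; exact: leq_maxl.
have [] := @fusion sg s1 (fun tau s => forall i, i \in iota 0 (size tau).+1 ->
    large U s1 tau (CodeSeq.decode i) ->
    forall y, cylinder tau s y -> hits tau (F (CodeSeq.decode i)) y) _ _ s1i.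
- by move=> tau s2 s3 h b i ii l y cy; exact: (h i ii l y (cylinder_beyond b cy)).
- move=> tau s2 st s21 s2i.
  apply: (@dense_seq _ (fun i s => large U s1 tau (CodeSeq.decode i) ->
    forall y, cylinder tau s y -> hits tau (F (CodeSeq.decode i)) y) s1) => //.
    by move=> i s3 s4 h ss l y cy; exact: (h l y (cylinder_subset ss cy)).
  move=> i s3 _ s31 s3i.
  have [l|no] := pselect (large U s1 tau (CodeSeq.decode i)); last by exists s3; split.
  have [s4 [s43 s4i h]] := F_dense tau (CodeSeq.decode i) s3 st l s31 s3i.
  by exists s4.
move=> s2 [s21 s2i hs2].
exists s2, (fun tau t => stem_over sg s2 tau /\ good (size tau) tau t); split.
- by split=> //; exact: subset_trans s1s.
- split; first by left.
  by split=> //; apply: large_her lsg _; exact: beyond_subset.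
- by move=> tau t [_ [_ l]]; exact: l.
- move=> tau t y [st [ct l]] cy.
  have [m tm [n [cn ln]]] : hits tau (F t) y.
    rewrite -[t]CodeSeq.codeK; apply: hs2 => //; last by rewrite CodeSeq.codeK.
    by rewrite mem_iota.
  rewrite size_mkseq in cn; exists m, n; split=> //.
    by apply: leq_trans cn; rewrite -(size_rcons t n); exact: size_code.
  split; first exact: stem_over_mkseq cy _.
  by split=> //; rewrite size_mkseq.
Qed.

(** * Locally constant maps and coordinates *)

(** Being locally constant makes sense for values in an arbitrary type and is
    preserved by all operations on values.  It is the working form of clopen,
    for predicates, and of continuous, for maps to a discrete space. *)
Definition locally_constant (X : topologicalType) (T : Type) (f : X -> T) : Prop :=
  forall a, \forall b \near a, f b = f a.

Section LocallyConstant.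
Variable X : topologicalType.

Lemma lc_cst (T : Type) (c : T) : locally_constant (fun _ : X => c).
Proof. by move=> a; exact: nearW. Qed.

Lemma lc_bind (S T : Type) (g : X -> S) (F : S -> X -> T) :
  locally_constant g -> (forall s, locally_constant (F s)) ->
  locally_constant (fun a => F (g a) a).
Proof.
move=> lg lF a; have := lF (g a) a; have := lg a.
by apply: filterS2 => b /= -> ->.
Qed.

Lemma lc_comp (S T : Type) (h : S -> T) (g : X -> S) :
  locally_constant g -> locally_constant (fun a => h (g a)).
Proof. by move=> lg; apply: (lc_bind (F := fun s _ => h s) lg) => s; exact: lc_cst. Qed.

Lemma lc_comp2 (S1 S2 T : Type) (h : S1 -> S2 -> T) (g1 : X -> S1) (g2 : X -> S2) :
  locally_constant g1 -> locally_constant g2 ->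
  locally_constant (fun a => h (g1 a) (g2 a)).
Proof.
by move=> l1 l2; apply: (lc_bind (F := fun s a => h s (g2 a)) l1) => s; exact: lc_comp.
Qed.

Lemma lc_not (P : X -> Prop) : locally_constant P -> locally_constant (fun a => ~ P a).
Proof. exact: lc_comp. Qed.

Lemma lc_and (P Q : X -> Prop) : locally_constant P -> locally_constant Q ->
  locally_constant (fun a => P a /\ Q a).
Proof. exact: lc_comp2. Qed.

Lemma lc_imp (P Q : X -> Prop) : locally_constant P -> locally_constant Q ->
  locally_constant (fun a => P a -> Q a).
Proof. exact: (lc_comp2 (fun A B : Prop => A -> B)). Qed.

Lemma lc_mkseq (T : Type) (f : X -> nat -> T) (g : X -> nat) :
  (forall i, locally_constant (f^~ i)) -> locally_constant g ->
  locally_constant (fun a => mkseq (f a) (g a)).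
Proof.
move=> lf lg; apply: (lc_bind (F := fun n a => mkseq (f a) n)) => // n.
elim: n => [|n IH]; first exact: lc_cst.
rewrite (_ : (fun a => _) = fun a => rcons (mkseq (f a) n) (f a n)).
  exact: lc_comp2.
by apply/funext => a; rewrite mkseqS.
Qed.

Lemma lc_all (I : Type) (P : I -> X -> bool) (s : seq I) :
  (forall i, locally_constant (P i)) ->
  locally_constant (fun a => all (fun i => P i a) s).
Proof.
by move=> lP; elim: s => [|i s IH]; [exact: lc_cst|exact: (lc_comp2 andb)].
Qed.

Lemma closed_forall (I : Type) (P : I -> X -> Prop) :
  (forall i, locally_constant (P i)) -> closed [set a | forall i, P i a].
Proof.
move=> lP a ca i; have [b [Pb ab]] := ca _ (lP i a).
by rewrite -ab; exact: Pb.
Qed.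

End LocallyConstant.

Lemma lc_continuous (X Y : topologicalType) (T : Type) (g : X -> Y) (f : Y -> T) :
  continuous g -> locally_constant f -> locally_constant (fun a => f (g a)).
Proof. by move=> cg lf a; exact: (cg a _ (lf (g a))). Qed.

Lemma lc_fst (X Y : topologicalType) (T : Type) (f : X -> T) :
  locally_constant f -> locally_constant (fun a : X * Y => f a.1).
Proof. by apply: lc_continuous => a; exact: cvg_fst. Qed.

Lemma lc_snd (X Y : topologicalType) (T : Type) (f : Y -> T) :
  locally_constant f -> locally_constant (fun a : X * Y => f a.2).
Proof. by apply: lc_continuous => a; exact: cvg_snd. Qed.

(** The space X has the initial topology of the map e to a product of discrete
    spaces, expressed through finite initial segments.  All spaces in play are
    used only through such maps. *)
Definition coordinates (X : topologicalType) (T : Type) (e : X -> nat -> T) : Prop :=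
  (forall i, locally_constant (e^~ i)) /\
  forall (a : X) (U : set X), nbhs a U ->
    exists n, forall b, mkseq (e b) n = mkseq (e a) n -> U b.

Lemma coordinates_prod (K : discreteTopologicalType) :
  @coordinates (prod_topology (fun _ : nat => K)) K id.
Proof.
split=> [i a|a U nU].
  exact: (@proj_continuous nat (fun=> K) i a _ (discrete_set1 (a i))).
pose B n := [set b : prod_topology (fun _ : nat => K) | mkseq b n = mkseq a n].
have BF : Filter (filter_from [set: nat] B).
  apply: filter_from_filter; first by exists 0.
  move=> m n _ _; exists (maxn m n) => // b /= /mkseq_eqP bmn.
  by split; apply/mkseq_eqP => i im; apply: bmn; rewrite leq_max im ?orbT.
suff : filter_from [set: nat] B --> a.
  by move=> /(_ U nU) [n _ BU]; exists n => b /BU.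
apply/cvg_sup => i V [_ [[W oW <-] Wa WV]].
exists i.+1 => // b /mkseq_eqP ba; apply: WV => /=.
by rewrite ba.
Qed.

Lemma coordinates_baire : @coordinates baire_space nat id.
Proof. exact: coordinates_prod. Qed.

Lemma coordinates_cantor : @coordinates cantor_space bool id.
Proof. exact: coordinates_prod. Qed.

Lemma coordinates_infset : @coordinates infset nat enumeration.
Proof.
have [lc nb] := coordinates_baire; split=> [i|a U [_ [[W oW <-] Wa WU]]].
  apply: (lc_continuous (f := fun y : baire_space => y i)) (lc i).
  exact: (@initial_continuous infset baire_space enumeration).
have [|n nW] := nb (enumeration a) W; first exact: open_nbhs_nbhs.
by exists n => b /nW Wb; apply: WU.
Qed.

Lemma continuous_coordinates (X Y : topologicalType) (T : Type)
    (e : Y -> nat -> T) (g : X -> Y) :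
  coordinates e -> (forall i, locally_constant (fun a => e (g a) i)) ->
  continuous g.
Proof.
move=> [_ nb] lg a U /nb[n nU].
have : \forall b \near a, mkseq (e (g b)) n = mkseq (e (g a)) n.
  exact: (lc_mkseq (f := fun a => e (g a)) lg (@lc_cst X nat n)).
by apply: filterS => b /nU.
Qed.

Lemma continuous_pair (X Y Z : topologicalType) (f : X -> Y) (g : X -> Z) :
  continuous f -> continuous g -> continuous (fun a => (f a, g a)).
Proof. by move=> cf cg a; exact: (cvg_pair (cf a) (cg a)). Qed.

Section Boxes.
Variables (X Y W : topologicalType) (S T V : Type).
Variables (eX : X -> nat -> S) (eY : Y -> nat -> T) (eW : W -> nat -> V).

(** Membership in the tree of a closed set C.  The three sequences may have
    different lengths, which lets certificates treat them separately. *)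
Definition box_meets (C : set (X * Y * W)) (a : seq S) (b : seq T) (c : seq V) :=
  exists x y w, [/\ C (x, y, w), mkseq (eX x) (size a) = a,
    mkseq (eY y) (size b) = b & mkseq (eW w) (size c) = c].

Lemma mkseq_take (U : Type) (f : nat -> U) (u : seq U) n :
  mkseq f (size u) = u -> mkseq f (size (take n u)) = take n u.
Proof.
by move=> fu; rewrite -[in RHS]fu -map_take take_iota size_take_min.
Qed.

Lemma box_meets_take C n a b c :
  box_meets C a b c -> box_meets C (take n a) (take n b) (take n c).
Proof.
by move=> [x [y [w [Cxyw xa yb wc]]]]; exists x, y, w; split=> //; exact: mkseq_take.
Qed.

Hypotheses (cX : coordinates eX) (cY : coordinates eY) (cW : coordinates eW).

Lemma closed_box (C : set (X * Y * W)) x y w : closed C ->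
  (forall n, box_meets C (mkseq (eX x) n) (mkseq (eY y) n) (mkseq (eW w) n)) ->
  C (x, y, w).
Proof.
move=> clC meet; apply: clC => O [[A B] /= [[[P Q] /= [xP yQ] PQA] wB] AB].
have [k kP] := cX.2 _ _ xP; have [l lQ] := cY.2 _ _ yQ; have [m mB] := cW.2 _ _ wB.
have le_take (U : Type) (f g : nat -> U) i j : (i <= j)%N ->
    mkseq f (size (mkseq g j)) = mkseq g j -> mkseq f i = mkseq g i.
  move=> ij; rewrite size_mkseq => fg.
  have tk (h : nat -> U) : mkseq h i = take i (mkseq h j).
    by rewrite -map_take take_iota (minn_idPl ij).
  by rewrite !tk fg.
have [x' [y' [w' [C' xx yy ww]]]] := meet (maxn k (maxn l m)).
exists (x', y', w'); split=> //; apply: AB; split=> /=.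
  apply: PQA; split=> /=; [apply: kP; apply: le_take xx|apply: lQ; apply: le_take yy].
    by rewrite leq_max leqnn.
  by rewrite !leq_max leqnn !orbT.
by apply: mB; apply: le_take ww; rewrite !leq_max leqnn !orbT.
Qed.

End Boxes.

(** * Closure properties of analytic sets *)

Lemma Sigma11_exists (X : topologicalType) (C : set (X * baire_space)) :
  closed C -> Sigma11 [set x | exists p, C (x, p)].
Proof.
move=> clC; exists C => //; apply/seteqP; split=> [x [p Cxp]|x [[x1 p] Cxp <-]].
  by exists (x, p).
by exists p.
Qed.

Lemma Sigma11_closed (X : topologicalType) (P : set X) : closed P -> Sigma11 P.
Proof.
move=> clP; have := @Sigma11_exists X (fst @^-1` P).
rewrite (_ : [set x | _] = P).
  by apply; apply: preimage_closed clP => a _; exact: cvg_fst.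
by apply/seteqP; split=> [x [_ ?] //|x Px]; exists (fun=> 0%N).
Qed.

(** The first entry of the new witness names the member of the family, and the
    rest is a witness for that member. *)
Lemma Sigma11_countable (X : topologicalType) (I : countType) (P : I -> set X) :
  (forall i, Sigma11 (P i)) -> Sigma11 [set x | exists i, P i x].
Proof.
move=> SP.
have /choice[C clC] : forall i, exists C : set (X * baire_space),
    closed C /\ P i = fst @` C by move=> i; have [C ? ?] := SP i; exists C.
pose sh (a : X * baire_space) : X * baire_space := (a.1, fun n => a.2 n.+1).
have sh_cont : continuous sh.
  apply: continuous_pair; first by move=> a; exact: cvg_fst.
  apply: (continuous_coordinates (g := fun a : X * baire_space =>
    (fun n => a.2 n.+1) : baire_space) coordinates_baire) => i.
  exact: lc_snd (coordinates_baire.1 i.+1).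
pose D := [set a : X * baire_space | exists2 i : I, choice.pickle i = a.2 0%N & C i (sh a)].
have clD : closed D.
  move=> a clDa.
  have near0 : \forall b \near a, b.2 0%N = a.2 0%N.
    exact: lc_snd (coordinates_baire.1 0%N) a.
  have [b [[i ib _] /= ba]] := clDa _ near0.
  exists i; first by rewrite ib ba.
  apply: (proj1 (clC i)) => V /sh_cont nV; have {}nV : nbhs a (sh @^-1` V) by [].
  have [b' [[i' ib' Cb'] [/= Vb' ba']]] := clDa _ (filterI nV near0).
  exists (sh b'); split=> //; suff -> : i = i' by [].
  by apply: (pcan_inj (@choice.pickleK I)); rewrite ib ib' ba ba'.
rewrite (_ : [set x | _] = [set x | exists p, D (x, p)]).
  exact: Sigma11_exists.
apply/seteqP; split=> x.
  move=> [i]; rewrite (clC i).2 => -[[x1 p] Cp <-].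
  exists (fun n => if n is n'.+1 then p n' else choice.pickle i); exists i => //.
move=> [p [i _ Ci]]; exists i; rewrite (clC i).2.
by exists (sh (x, p)).
Qed.

(** * Ellentuck neighbourhoods through enumerations *)

Lemma enumeration_increasing (Y : infset) : increasing (enumeration Y).
Proof. by have [] := enumerationP Y. Qed.

Lemma range_enumeration (Y : infset) : range (enumeration Y) = Y.
Proof. by have [] := enumerationP Y. Qed.

Lemma enumeration_mem (Y : infset) i : infset_val Y (enumeration Y i).
Proof. by rewrite -range_enumeration; exists i. Qed.

Definition range_infset (y : nat -> nat) (yi : increasing y) : infset :=
  InfSet (range_infinite yi).

Lemma enumeration_range_infset (y : nat -> nat) (yi : increasing y) :
  enumeration (range_infset yi) = y.
Proof.
apply: (is_enumeration_inj (s := range y)); last by split.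
exact: (enumerationP (range_infset yi)).
Qed.

Lemma enumerationE (Y : infset) (y : nat -> nat) :
  increasing y -> range y = Y -> enumeration Y = y.
Proof. by move=> yi yY; exact: is_enumeration_inj (enumerationP Y) _. Qed.

Definition glue (tau : seq nat) (e : nat -> nat) (i : nat) : nat :=
  if (i < size tau)%N then nth 0 tau i else e (i - size tau)%N.

Lemma glue_ge tau e i : (size tau <= i)%N -> glue tau e i = e (i - size tau)%N.
Proof. by rewrite /glue ltnNge => ->. Qed.

Lemma glue_mkseq tau e : mkseq (glue tau e) (size tau) = tau.
Proof.
apply: (@eq_from_nth _ 0); rewrite size_mkseq // => i it.
by rewrite nth_mkseq // /glue it.
Qed.

Lemma glue_increasing tau e : sorted ltn tau -> increasing e ->
  all (fun i => i < e 0)%N tau -> increasing (glue tau e).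
Proof.
move=> st ei te; apply: increasingS => n; rewrite /glue.
case: (ltnP n.+1 (size tau)) => nt.
  by rewrite (ltnW nt) (sorted_ltn_nth ltn_trans) // inE ltnW.
case: (ltnP n (size tau)) => nt'; last by rewrite subSn //; exact: ei.
have -> : (n.+1 - size tau)%N = 0 by apply/eqP; rewrite subn_eq0.
by apply: (allP te); exact: mem_nth.
Qed.

Lemma glue_range tau e : range (glue tau e) = [set` tau] `|` range e.
Proof.
apply/seteqP; split=> [_ [i _ <-]|j [/= jt|[i _ <-]]].
- rewrite /glue; case: (ltnP i (size tau)) => it; first by left; exact: mem_nth.
  by right; exists (i - size tau)%N.
- by exists (index j tau) => //; rewrite /glue index_mem jt nth_index.
- by exists (i + size tau)%N => //; rewrite glue_ge ?leq_addl ?addnK.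
Qed.

Definition sorted_stem (sg : {fset nat}) : seq nat := sort leq sg.

Lemma sorted_stem_sorted sg : sorted ltn (sorted_stem sg).
Proof. by rewrite ltn_sorted_uniq_leq sort_uniq fset_uniq (sort_sorted leq_total). Qed.

Lemma mem_sorted_stem sg : sorted_stem sg =i sg.
Proof. by move=> i; rewrite mem_sort. Qed.

(** When sg lies below s, passing to the enumeration of Y splits it into the
    increasing listing of sg and an enumeration e of the part of Y inside s. *)
Lemma ellentuck_enumeration (sg : {fset nat}) (s Y : infset) :
  (forall i j : nat, i \in sg -> infset_val s j -> (i < j)%N) ->
  ellentuck sg s Y ->
  exists e, [/\ increasing e, range e `<=` s, range e `<=` Y &
                enumeration Y = glue (sorted_stem sg) e].
Proof.
move=> sgs [sgY Ysgs].
have Di : infinite_set (Y `\` [set` sg]).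
  by apply: infinite_setD; [exact: infset_infinite|exact: finite_fset].
pose e := enumeration (InfSet Di).
have eD i : (Y `\` [set` sg]) (e i) by exact: (@enumeration_mem (InfSet Di)).
have es i : infset_val s (e i) by have [/Ysgs[]] := eD i.
have ei : increasing e by exact: enumeration_increasing.
exists e; split=> //.
- by move=> _ [i _ <-].
- by move=> _ [i _ <-]; have [] := eD i.
apply: enumerationE.
  apply: glue_increasing => //; first exact: sorted_stem_sorted.
  by apply/allP => i; rewrite mem_sorted_stem => isg; exact: sgs.
rewrite glue_range -[in X in _ `|` X]/(range e) range_enumeration /=.
apply/seteqP; split=> [j [/=|[]//]|j Yj]; first by rewrite mem_sorted_stem => /sgY.
have [jsg|jsg] := boolP (j \in sg); [left|right].
  by rewrite /= mem_sorted_stem.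
by split=> //=; apply/negP.
Qed.

(** * Positivity of sections of an analytic set is Sigma^1_2 *)

Section Witness.
Variables (X : topologicalType) (S : Type) (eX : X -> nat -> S).
Hypothesis cX : coordinates eX.
Variable C : set (X * infset * baire_space).
Hypothesis clC : closed C.

Let meets := box_meets eX enumeration (id : baire_space -> nat -> nat) C.

(** In the third condition the coordinates of x are cut at the length of t.  As
    the last condition makes tau and t grow together without bound, this
    precision suffices to reach a point of C in the limit, and it keeps the
    condition clopen in x. *)
Definition witness (x : X) (s : set nat) (L : seq nat -> seq nat -> Prop) :=
  [/\ exists sg, L sg [::], infinite_set s,
      forall tau t, L tau t -> meets (mkseq (eX x) (size t)) tau t &
      forall tau t y, L tau t -> cylinder tau s y ->
        exists m n, [/\ (size tau <= m)%N, (size t < m)%N &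
                        L (mkseq y m) (rcons t n)]].

Let fiber (x : X) : set infset := [set Y | exists z, C (x, Y, z)].

Lemma positive_witness x : ramsey_positive (fiber x) -> exists s L, witness x s L.
Proof.
move=> /existsNP[sg /existsNP[s /not_implyP[sgs pos]]].
pose U t (y : nat -> nat) := exists (Y : infset) (z : baire_space),
  [/\ enumeration Y = y, C (x, Y, z) & mkseq z (size t) = t].
have [|||s' [L [[s's s'i] L0 Lm Ls]]] :=
    @large_uniformize U (sorted_stem sg) s.
- move=> t y [Y [z [Yy CYz zt]]]; exists (z (size t)), Y, z; split=> //.
  by rewrite size_rcons mkseqS zt.
- exact: infset_infinite.
- move=> s1 s1s s1i; apply: contrapT => no; apply: pos.
  exists (InfSet s1i); first exact: s1s.
  apply/seteqP; split=> // Y [eY [z CYz]]; apply: no.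
  have sgs1 : forall i j : nat, i \in sg -> infset_val (InfSet s1i) j -> (i < j)%N.
    by move=> i j isg /s1s; exact: sgs.
  have [e [ei es _ Ye]] := ellentuck_enumeration sgs1 eY.
  exists (enumeration Y); last by exists Y, z.
  split; first exact: enumeration_increasing.
    by rewrite Ye glue_mkseq.
  by move=> i ti; rewrite Ye glue_ge //; apply: es; exists (i - size (sorted_stem sg))%N.
exists s', L; split=> //; first by exists (sorted_stem sg).
move=> tau t /Lm[y [yi yt ys] [Y [z [Yy CYz zt]]]]; exists x, Y, z; split=> //.
  by rewrite size_mkseq.
by rewrite Yy.
Qed.

(** Against a set s' that nullity would provide, let y enumerate the union of sg
    and s'.  Starting from the pair (sg, [::]) and using the extension property
    again and again yields longer and longer stems of y and a sequence z in the
    limit; the boxes around (x, y, z) all meet C, which is closed. *)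
Lemma witness_positive x s L : witness x s L -> ramsey_positive (fiber x).
Proof.
move=> [[sg Lsg] si Lm Ls] null.
have ssg : sorted ltn sg.
  have [x0 [Y0 [z0 [_ _ Y0sg _]]]] := Lm _ _ Lsg.
  by rewrite -Y0sg; apply: mkseq_sorted; exact: enumeration_increasing.
pose M := (\max_(i <- sg) i)%N.
have s1i := infinite_above (n := M) si.
have s1P : forall i j : nat, i \in [fset i in sg]%fset -> infset_val (InfSet s1i) j -> (i < j)%N.
  by move=> i j; rewrite inE /= => isg [_ /all_lt_bigmax /allP]; exact.
have [s' s's1 disj] := null _ _ s1P.
pose y := glue sg (enumeration s').
have yi : increasing y.
  apply: glue_increasing => //; first exact: enumeration_increasing.
  apply/allP => i isg; apply: s1P; first by rewrite inE.
  by apply: s's1; exact: enumeration_mem.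
have ycyl : cylinder sg s y.
  split=> //; first exact: glue_mkseq.
  move=> i sgi; rewrite /y glue_ge //.
  by have [] := s's1 _ (enumeration_mem s' (i - size sg)).
pose R (a b : nat * seq nat) := L (mkseq y a.1) a.2 -> (size sg <= a.1)%N ->
  [/\ L (mkseq y b.1) b.2, (size sg <= b.1)%N, (size a.2 < b.1)%N &
      exists n, b.2 = rcons a.2 n].
have exR a : {b | R a b}.
  apply: cid; have [[La sga]|no] := pselect (L (mkseq y a.1) a.2 /\ (size sg <= a.1)%N).
    have [m [n [am tm Lmn]]] := Ls _ _ y La (cylinder_mkseq ycyl sga).
    rewrite size_mkseq in am.
    exists (m, rcons a.2 n) => _ _; split=> //; first exact: leq_trans sga am.
    by exists n.
  by exists a => La sga; case: no.
have [f [f0 fR]] := dependent_choice exR (size sg, [::]).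
have finv k : [/\ L (mkseq y (f k).1) (f k).2, (size sg <= (f k).1)%N & size (f k).2 = k].
  elim: k => [|k [Lk sk tk]]; first by rewrite f0 /=; split=> //; rewrite glue_mkseq.
  have [L' s'' _ [n fn]] := fR k Lk sk; split=> //.
  by rewrite fn size_rcons tk.
pose z : baire_space := fun k => nth 0%N (f k.+1).2 k.
have zf k : mkseq z k = (f k).2.
  elim: k => [|k IH]; first by rewrite f0.
  have [Lk sk tk] := finv k; have [_ _ _ [n fn]] := fR k Lk sk.
  by rewrite mkseqS IH /z fn nth_rcons tk ltnn eqxx.
have fge k : (k <= (f k).1)%N.
  case: k => // k; have [Lk sk tk] := finv k; have [_ _ + _] := fR k Lk sk.
  by rewrite tk.
have CY : C (x, range_infset yi, z).
  apply: (closed_box cX coordinates_infset coordinates_baire clC) => n.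
  have [Ln _ tn] := finv n; have := box_meets_take n (Lm _ _ Ln).
  by rewrite tn !take_mkseq // -zf take_mkseq // enumeration_range_infset.
have : (ellentuck [fset i in sg]%fset s' `&` fiber x) (range_infset yi).
  split; last by exists z.
  have yE : infset_val (range_infset yi) = [set` sg] `|` s'.
    by rewrite -(range_enumeration s'); exact: glue_range.
  split=> j; rewrite yE; first by rewrite /= inE => jsg; left.
  by move=> [/= jsg|s'j]; [left; rewrite /= inE|right].
by rewrite disj.
Qed.

(** A real v codes a set and a relation by the zeros of v, through a numbering
    of the potential elements of both. *)
Definition decode_set (v : baire_space) : set nat :=
  [set n | v (choice.pickle (inl n : nat + seq nat * seq nat)) = 0%N].

Definition decode_rel (v : baire_space) (tau t : seq nat) : Prop :=
  v (choice.pickle (inr (tau, t) : nat + seq nat * seq nat)) = 0%N.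

Lemma decode_onto (s : set nat) (L : seq nat -> seq nat -> Prop) :
  exists v, decode_set v = s /\ decode_rel v = L.
Proof.
exists (fun j => match choice.unpickle j with
  | Some (inl n) => ~~ `[< s n >]
  | Some (inr (tau, t)) => ~~ `[< L tau t >]
  | None => false end : nat); split.
  apply/seteqP; split=> n; rewrite /decode_set /= choice.pickleK.
    by case: asboolP.
  by move=> sn; rewrite asboolT.
apply/funext => tau; apply/funext => t; rewrite /decode_rel /= choice.pickleK.
by apply/propext; case: asboolP.
Qed.

(** The negation is a countable union of sets which are closed, apart from an
    existential quantifier over y in the last case. *)
Lemma not_witnessP x (s : set nat) (L : seq nat -> seq nat -> Prop) :
  ~ witness x s L <->
  [\/ forall sg, ~ L sg [::], exists N, forall n, (N < n)%N -> ~ s n,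
      exists tau t, L tau t /\ ~ meets (mkseq (eX x) (size t)) tau t |
      exists tau t y, [/\ L tau t, cylinder tau s y &
        forall m n, ~ [/\ (size tau <= m)%N, (size t < m)%N &
                          L (mkseq y m) (rcons t n)]]].
Proof.
split=> [nw|].
  apply: contrapT => no; apply: nw; split.
  - apply: contrapT => h; apply: no; apply: Or41 => sg Lsg.
    by apply: h; exists sg.
  - apply: unbounded_infinite => N; apply: contrapT => h; apply: no; apply: Or42.
    by exists N => n Nn sn; apply: h; exists n.
  - move=> tau t Lt; apply: contrapT => h; apply: no; apply: Or43.
    by exists tau, t.
  - move=> tau t y Lt cy; apply: contrapT => h; apply: no; apply: Or44.
    by exists tau, t, y; split=> // m n mn; apply: h; exists m, n.
move=> [no|[N sN]|[tau [t [Lt no]]]|[tau [t [y [Lt cy no]]]]] [[sg Lsg] si Lm Ls].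
- exact: no Lsg.
- by have [n sn /sN] := infinite_ex N si.
- exact: no (Lm _ _ Lt).
- by have [m [n mn]] := Ls _ _ _ Lt cy; exact: no mn.
Qed.

Lemma Sigma12_positive : Sigma12 [set x | ramsey_positive (fiber x)].
Proof.
exists [set a : X * baire_space | witness a.1 (decode_set a.2) (decode_rel a.2)]; last first.
  apply/seteqP; split=> [x /positive_witness[s [L w]]|_ [[x v] /= w <-]].
    by have [v [vs vL]] := decode_onto s L; exists (x, v) => //=; rewrite vs vL.
  exact: witness_positive w.
rewrite /Pi11.
have lcL tau t : locally_constant (fun a : X * baire_space => decode_rel a.2 tau t).
  apply: (lc_snd (f := fun v : baire_space => decode_rel v tau t)).
  exact: (lc_comp (fun k => k = 0%N) (coordinates_baire.1 _)).
have lcset n : locally_constant (fun a : X * baire_space => decode_set a.2 n).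
  apply: (lc_snd (f := fun v : baire_space => decode_set v n)).
  exact: (lc_comp (fun k => k = 0%N) (coordinates_baire.1 _)).
pose P (i : unit + nat + seq nat * seq nat + seq nat * seq nat) : set (X * baire_space) :=
  match i with
  | inl (inl (inl tt)) => [set a | forall sg, ~ decode_rel a.2 sg [::]]
  | inl (inl (inr N)) => [set a | forall n, (N < n)%N -> ~ decode_set a.2 n]
  | inl (inr (tau, t)) =>
      [set a | decode_rel a.2 tau t /\ ~ meets (mkseq (eX a.1) (size t)) tau t]
  | inr (tau, t) => [set a | exists y, [/\ decode_rel a.2 tau t,
      cylinder tau (decode_set a.2) y &
      forall m n, ~ [/\ (size tau <= m)%N, (size t < m)%N &
                        decode_rel a.2 (mkseq y m) (rcons t n)]]]
  end.
rewrite (_ : ~` _ = [set a | exists i, P i a]); last first.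
  apply/seteqP; split=> [a /not_witnessP|a [i Pia]].
    move=> [h|[N h]|[tau [t h]]|[tau [t [y h]]]].
    - by exists (inl (inl (inl tt))).
    - by exists (inl (inl (inr N))).
    - by exists (inl (inr (tau, t))).
    - by exists (inr (tau, t)); exists y.
  apply/not_witnessP; move: i Pia => [[[[]|N]|[tau t]]|[tau t]] /=.
  - exact: Or41.
  - by move=> h; apply: Or42; exists N.
  - by move=> h; apply: Or43; exists tau, t.
  - by move=> [y h]; apply: Or44; exists tau, t, y.
apply: Sigma11_countable => -[[[[]|N]|[tau t]]|[tau t]] /=.
- apply: Sigma11_closed; apply: (closed_forall (P := fun sg a => ~ decode_rel a.2 sg [::])) => sg.
  exact: lc_not (lcL sg [::]).
- apply: Sigma11_closed.
  apply: (closed_forall (P := fun n a => (N < n)%N -> ~ decode_set a.2 n)) => n.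
  exact: (lc_comp (fun A => (N < n)%N -> ~ A) (lcset n)).
- apply: Sigma11_closed.
  rewrite (_ : [set a | _] = [set a | forall _ : unit, decode_rel a.2 tau t /\
    ~ meets (mkseq (eX a.1) (size t)) tau t]).
    apply: closed_forall => _; apply: (lc_comp2 (fun A u => A /\ ~ meets u tau t) (lcL tau t)).
    apply: (lc_fst (f := fun x => mkseq (eX x) (size t))).
    exact: (lc_mkseq cX.1 (lc_cst _)).
  by apply/seteqP; split=> a //= /(_ tt).
(* Spreading the conditions that define the cylinder over all k leaves a
   single countable family of locally constant predicates. *)
- pose Q (kn : nat * nat) (a : X * baire_space * baire_space) : Prop :=
    let k := kn.1 in
    decode_rel a.1.2 tau t /\ (a.2 k < a.2 k.+1)%N /\ mkseq a.2 (size tau) = tau /\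
    ((size tau <= k)%N -> decode_set a.1.2 (a.2 k)) /\
    ~ [/\ (size tau <= k)%N, (size t < k)%N &
          decode_rel a.1.2 (mkseq a.2 k) (rcons t kn.2)].
  rewrite (_ : [set a | _] = [set a | exists y, [set b | forall kn, Q kn b] (a, y)]).
    apply: Sigma11_exists; apply: (closed_forall (P := Q)) => -[k n]; rewrite /Q /=.
    have lc2 i : locally_constant (fun a : X * baire_space * baire_space => a.2 i).
      exact: lc_snd (coordinates_baire.1 i).
    apply: lc_and; first exact: lc_fst (lcL tau t).
    apply: lc_and; first exact: (lc_comp2 (fun i j : nat => (i < j)%N : Prop) (lc2 _) (lc2 _)).
    apply: lc_and.
      apply: (lc_comp (fun u => u = tau)).
      exact: (lc_mkseq (f := fun a : X * baire_space * baire_space => a.2) _ (lc_cst _)).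
    apply: lc_and.
      apply: lc_imp; first exact: lc_cst.
      apply: (lc_bind (F := fun i (a : X * baire_space * baire_space) => decode_set a.1.2 i)) => // i.
      exact: lc_fst (lcset i).
    apply: lc_not.
    apply: (lc_comp (fun A => [/\ (size tau <= k)%N, (size t < k)%N & A])).
    apply: (lc_bind (F := fun u (a : X * baire_space * baire_space) =>
      decode_rel a.1.2 u (rcons t n)) (lc_mkseq _ (lc_cst _))) => // u.
    exact: lc_fst (lcL u (rcons t n)).
  apply/seteqP; split=> -[x v] /= [y].
    move=> [Lt [yi yt ys] no]; exists y => -[k n]; split=> //; split; first exact: yi.
    by split=> //; split; [exact: ys|exact: no].
  move=> Qy; have [Lt [_ [yt _]]] := Qy (0, 0)%N; exists y; split=> //; last first.
    by move=> m n; have [_ [_ [_ [_ ]]]] := Qy (m, n).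
  split=> //; first by apply: increasingS => k; have [_ []] := Qy (k, 0)%N.
  by move=> i; have [_ [_ [_ []]]] := Qy (i, 0)%N.
Qed.

End Witness.

(** * The domination set *)

(** Koenig's lemma; the first hypothesis says both that T is a tree and that f
    bounds its nodes, so that branching is finite. *)
Lemma konig (T : seq nat -> Prop) (f : nat -> nat) :
  (forall u n, T (rcons u n) -> T u /\ (n <= f (size u))%N) ->
  (forall m, exists2 u, size u = m & T u) ->
  exists p, forall m, T (mkseq p m).
Proof.
move=> Trcons Tlong.
have T_take w k : T w -> T (take k w).
  elim/last_ind: w => [|w a IH] Tw; first by case: k.
  case: (ltngtP k (size w).+1) => [kw|kw|->].
  - rewrite -cats1 takel_cat; last by rewrite -ltnS.
    by apply: IH; case: (Trcons _ _ Tw).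
  - by rewrite take_oversize // size_rcons ltnW.
  - by rewrite -(size_rcons w a) take_size.
pose alive u := forall m, (size u <= m)%N ->
  exists w, [/\ size w = m, T w & take (size u) w = u].
have exS u : {n | alive u -> alive (rcons u n)}.
  apply: cid; have [al|?] := pselect (alive u); last by exists 0%N.
  apply: contrapT => /forallNP no.
  have /choice[m mP] : forall n, exists m, (size u < m)%N /\
      ~ exists w, [/\ size w = m, T w & take (size u).+1 w = rcons u n].
    move=> n; have /not_implyP[_ /existsNP[m /not_implyP[um nw]]] := no n.
    by exists m; rewrite size_rcons in um nw.
  pose M := (\max_(n < (f (size u)).+1) m n)%N.
  have mM n : (n <= f (size u))%N -> (m n <= M)%N.
    rewrite -ltnS => nf; exact: (leq_bigmax (F := fun i : 'I__ => m i) (Ordinal nf)).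
  have uM : (size u < M)%N by apply: leq_trans (mM 0%N _) => //; case: (mP 0%N).
  have [w [wM Tw wu]] := al M (ltnW uM).
  have wS : take (size u).+1 w = rcons u (nth 0%N w (size u)).
    by rewrite (take_nth 0%N) ?wM // wu.
  have /Trcons[_ nf] : T (rcons u (nth 0%N w (size u))) by rewrite -wS; exact: T_take.
  have [um []] := mP (nth 0%N w (size u)).
  exists (take (m (nth 0%N w (size u))) w); split; last by rewrite take_takel.
    by rewrite size_takel // wM; exact: mM.
  exact: T_take.
have a0 : alive [::].
  by move=> m _; have [w wm Tw] := Tlong m; exists w; split=> //; rewrite take0.
pose F u := rcons u (projT1 (exS u)).
pose b n := iter n F [::].
have bal n : alive (b n) by elim: n => //= n IH; apply: (projT2 (exS (b n))).
have bs n : size (b n) = n by elim: n => //= n IH; rewrite size_rcons IH.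
pose p k := nth 0%N (b k.+1) k.
have bp n : mkseq p n = b n.
  by elim: n => // n IH; rewrite mkseqS IH /p /= nth_rcons bs ltnn eqxx.
exists p => m; have [|w [wm Tw wb]] := bal m m; first by rewrite bs.
by rewrite bp -wb; exact: T_take.
Qed.

Lemma increasing_subrange (h e : nat -> nat) :
  increasing h -> increasing e -> range e `<=` range h ->
  forall i, (h i <= e i)%N.
Proof.
move=> hi ei eh i.
have h_le j k : (j <= k)%N -> (h j <= h k)%N.
  by rewrite leq_eqVlt => /predU1P[->//|/hi/ltnW].
suff [j ij ->] : exists2 j, (i <= j)%N & e i = h j by exact: h_le.
elim: i => [|i [j ij eij]].
  by have [j _ hj] : range h (e 0%N) by [apply: eh; exists 0%N]; exists j.
have [k _ hk] : range h (e i.+1) by apply: eh; exists i.+1.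
exists k => //; apply: leq_ltn_trans ij _; rewrite ltnNge; apply/negP => /h_le.
by rewrite hk -eij leqNgt ei.
Qed.

Lemma increasing_above (p : nat -> nat) :
  exists2 g, increasing g & forall i, (p i <= g i)%N.
Proof.
exists (fun i => \sum_(j < i.+1) (p j).+1)%N => [|i].
  by apply: increasingS => n; rewrite [X in (_ < X)%N]big_ord_recr /= addnS ltnS leq_addr.
by rewrite big_ord_recr /= addnS leqW // leq_addl.
Qed.

Section Reduction.
Variables (Z : topologicalType) (e : Z -> nat -> bool).
Hypothesis cZ : coordinates e.
Variable D : set (Z * baire_space * baire_space).
Hypothesis clD : closed D.

Let meets := box_meets e (id : baire_space -> nat -> nat)
  (id : baire_space -> nat -> nat) D.

(** For each k, the sequence u runs through the nodes of length q k of the tree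
    of attempts at p with D(x, z, p), and no such node is dominated by y shifted
    by k.  The shifts make this insensitive to finitely many elements of the
    set enumerated by y, and stating a level at which the tree dies,
    instead of the absence of branches, makes it closed. *)
Definition cuts_dominated (x : nat -> bool) (z q : nat -> nat) (y : nat -> nat) : Prop :=
  forall k u, size u = q k ->
    (forall i, (i < q k)%N -> (nth 0%N u i <= y (i + k))%N) ->
    ~ meets (mkseq x (q k)) (mkseq z (q k)) u.

Definition codes_prefixes (y z : nat -> nat) : Prop :=
  forall n, CodeSeq.decode (y n) = mkseq z (size (CodeSeq.decode (y n))).

Definition domination_set : set (cantor_space * infset) :=
  [set a | exists z q, codes_prefixes (enumeration a.2) z /\
                       cuts_dominated a.1 z q (enumeration a.2)].

(** The two witnesses z and q are interleaved into one real. *)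
Lemma Sigma11_domination_set : Sigma11 domination_set.
Proof.
pose evens (p : nat -> nat) i := p i.*2.
pose odds (p : nat -> nat) i := p i.*2.+1.
pose Q (ku : nat * seq nat) (a : cantor_space * infset * baire_space) : Prop :=
  let y := enumeration a.1.2 in let z := evens a.2 in
  let m := odds a.2 ku.1 in
  CodeSeq.decode (y ku.1) = mkseq z (size (CodeSeq.decode (y ku.1))) /\
  (size ku.2 = m ->
    all (fun i => nth 0 ku.2 i <= y (i + ku.1))%N (iota 0 (size ku.2)) ->
    ~ meets (mkseq a.1.1 m) (mkseq z m) ku.2).
rewrite (_ : domination_set = [set a | exists p, [set b | forall ku, Q ku b] (a, p)]).
  apply: Sigma11_exists; apply: (closed_forall (P := Q)) => -[k u]; rewrite /Q /=.
  have lcp i : locally_constant (fun a : cantor_space * infset * baire_space => a.2 i).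
    exact: lc_snd (coordinates_baire.1 i).
  have lcy i : locally_constant
      (fun a : cantor_space * infset * baire_space => enumeration a.1.2 i).
    exact: lc_fst (lc_snd (coordinates_infset.1 i)).
  have lcx i : locally_constant (fun a : cantor_space * infset * baire_space => a.1.1 i).
    exact: lc_fst (lc_fst (coordinates_cantor.1 i)).
  have lcz i : locally_constant
      (fun a : cantor_space * infset * baire_space => evens a.2 i).
    exact: lcp.
  apply: lc_and.
    apply: (lc_comp2 (fun c v => CodeSeq.decode c = v) (lcy k)).
    apply: (lc_bind (F := fun c (a : cantor_space * infset * baire_space) =>
      mkseq (evens a.2) (size (CodeSeq.decode c))) (lcy k)) => c.
    exact: lc_mkseq lcz (lc_cst _).
  apply: lc_imp; first exact: (lc_comp (fun m => size u = m) (lcp _)).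
  apply: lc_imp.
    apply: (lc_comp is_true); apply: (lc_all (P := fun i
      (a : cantor_space * infset * baire_space) =>
      (nth 0 u i <= enumeration a.1.2 (i + k))%N)) => i.
    exact: (lc_comp (fun j => nth 0 u i <= j)%N (lcy (i + k)%N)).
  apply: lc_not; apply: (lc_comp2 (fun v w => meets v w u) (lc_mkseq lcx (lcp _))).
  exact: lc_mkseq lcz (lcp _).
apply/seteqP; split=> [[x Y] /= [z [q [Yz sh]]]|[x Y] /= [p Qp]].
  exists (fun i => if odd i then q i./2 else z i./2) => -[k u]; rewrite /Q /=.
  rewrite (_ : evens _ = z); last first.
    by apply/funext => i; rewrite /evens odd_double doubleK.
  rewrite /odds /= odd_double /= uphalf_double; split=> // uq /allP ub.
  apply: sh => // i iq; apply: ub.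
  by rewrite mem_iota uq.
exists (evens p), (odds p); split=> [n|k u uq ub].
  by have [] := Qp (n, [::]).
have [_] := Qp (k, u); apply=> //; apply/allP => i; rewrite mem_iota /= uq.
exact: ub.
Qed.

(** There are only finitely many initial segments of z of length at most i, so
    all but finitely many entries of an increasing sequence of codes are codes
    of longer ones.  Hence the entries determine z. *)
Lemma decode_unbounded (y : nat -> nat) (z : nat -> nat) i : increasing y ->
  exists n, forall m, (n <= m)%N -> CodeSeq.decode (y m) =
    mkseq z (size (CodeSeq.decode (y m))) -> (i < size (CodeSeq.decode (y m)))%N.
Proof.
move=> yi; exists (\max_(l < i.+1) CodeSeq.code (mkseq z l)).+1%N => m bm ymz.
rewrite ltnNge -ltnS; apply/negP => li.
have := leq_bigmax (F := fun l : 'I__ => CodeSeq.code (mkseq z l)) (Ordinal li).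
rewrite /= -ymz CodeSeq.decodeK leqNgt => /negP; apply.
exact: leq_trans bm (increasing_ge yi m).
Qed.

(** If no z works, let Y in [sg, s] be in the section at e a, with its z, and let
    p be a branch for this z.  A sufficiently sparse subset of Y has an
    enumeration f o g above p.  Each Y' in the cylinder of this subset codes
    the same z, as it shares infinitely many elements with Y, and its
    enumeration shifted by the size of sg dominates p; so it is not in the
    section.  If z works, the codes of all initial segments of z form a set all
    of whose infinite subsets are in the section, [konig] providing the
    levels q k. *)
Lemma domination_set_positive a : ramsey_positive (xsection domination_set (e a)) <->
  exists z, forall p, ~ D (a, z, p).
Proof.
split=> [pos|[z noD] null].
  apply: contrapT => /forallNP noz; apply: pos => sg s sgs.
  have hasD z : exists p, D (a, z, p).
    by apply: contrapT => /forallNP; exact: noz.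
  have [[Y [eY /xsectionP[z [q [/= Yz sh]]]]]|no] :=
      pselect (ellentuck sg s `&` xsection domination_set (e a) !=set0); last first.
    by exists s => //; apply: contrapT => /eqP/set0P.
  have [p Dp] := hasD z.
  have [f [fi fs fY _]] := ellentuck_enumeration sgs eY.
  have [g gi pg] := increasing_above p.
  have hi : increasing (f \o g) by move=> m n mn; apply/fi/gi.
  have s's : range (f \o g) `<=` s by move=> _ [i _ <-]; apply: fs; exists (g i).
  exists (range_infset hi) => //; apply/seteqP; split=> // Y' [eY'].
  move=> /xsectionP[z' [q' [/= Yz' sh']]].
  have [|f' [f'i f's f'Y' Y'E]] := @ellentuck_enumeration sg (range_infset hi) Y' _ eY'.
    by move=> i j isg /s's; exact: sgs.
  have ff' : forall i, (f (g i) <= f' i)%N by exact: increasing_subrange.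
  have on_range (W : infset) w (j : nat) : codes_prefixes (enumeration W) w ->
      infset_val W j -> CodeSeq.decode j = mkseq w (size (CodeSeq.decode j)).
    by move=> Ww; rewrite -range_enumeration => -[n _ <-].
  have zz' : z' = z.
    apply/funext => i; have [n nP] := decode_unbounded z i f'i.
    have f'z : CodeSeq.decode (f' n) = mkseq z (size (CodeSeq.decode (f' n))).
      apply: (on_range Y) => //; have [j _ <-] : range (f \o g) (f' n).
        by apply: f's; exists n.
      by apply: fY; exists (g j).
    have f'z' : CodeSeq.decode (f' n) = mkseq z' (size (CodeSeq.decode (f' n))).
      by apply: (on_range Y') => //; apply: f'Y'; exists n.
    have /mkseq_eqP := etrans (esym f'z') f'z; apply.
    exact: nP.
  pose k := size (sorted_stem sg).
  apply: (sh' k (mkseq p (q' k))); first by rewrite size_mkseq.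
    move=> i iq; rewrite nth_mkseq // Y'E glue_ge ?leq_addl // addnK.
    by apply: leq_trans (ff' i); apply: leq_trans (pg i) (increasing_ge fi _).
  by exists a, z, p; rewrite !size_mkseq zz'.
have si : infinite_set (range (fun n => CodeSeq.code (mkseq z n))).
  apply: unbounded_infinite => n; exists (CodeSeq.code (mkseq z n.+1)); first by exists n.+1.
  by apply: leq_trans (size_code _); rewrite size_mkseq.
have [//|Y Ys disj] := null fset0 (InfSet si).
suff : (ellentuck fset0 Y `&` xsection domination_set (e a)) Y by rewrite disj.
split; first by split=> j //; right.
have /choice[q qP] : forall k, exists m, ~ exists u, [/\ size u = m,
    (forall i, (i < m)%N -> (nth 0%N u i <= enumeration Y (i + k))%N) &
    meets (mkseq (e a) m) (mkseq z m) u].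
  move=> k.
  apply: contrapT => /forallNP all_m.
  pose T u := (forall i, (i < size u)%N -> (nth 0%N u i <= enumeration Y (i + k))%N) /\
    meets (mkseq (e a) (size u)) (mkseq z (size u)) u.
  have [||p pT] := @konig T (fun i => enumeration Y (i + k)).
  - move=> u n [ub um]; rewrite size_rcons in ub um; split; last first.
      by have := ub (size u) (ltnSn _); rewrite nth_rcons ltnn eqxx.
    split=> [i iu|].
      by have := ub i (ltnW iu); rewrite nth_rcons iu.
    have := box_meets_take (size u) um.
    by rewrite !take_mkseq // -cats1 take_size_cat.
  - move=> m; have /contrapT[u [um ub uT]] := all_m m.
    by exists u => //; split; rewrite um.
  apply: (noD p); apply: (closed_box cZ coordinates_baire coordinates_baire clD) => n.
  by have [_] := pT n; rewrite size_mkseq.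
apply/xsectionP; exists z, q; split=> [n|k u uq ub um]; last by case: (qP k); exists u.
have [m _ <-] := Ys _ (enumeration_mem Y n).
by rewrite CodeSeq.codeK size_mkseq.
Qed.

End Reduction.

(** * Clopen coordinates on a zero-dimensional Polish space *)

Lemma clopen_lc (X : topologicalType) (W : set X) :
  clopen W -> locally_constant (fun a => `[< W a >]).
Proof.
move=> [oW cW] a; have [Wa|nWa] := pselect (W a).
  have : nbhs a W by apply: open_nbhs_nbhs.
  by apply: filterS => b Wb; rewrite !asboolT.
have : nbhs a (~` W) by apply: open_nbhs_nbhs; split=> //; exact: closed_openC.
by apply: filterS => b nWb; rewrite !asboolF.
Qed.

Section PolishCoordinates.
Local Open Scope ring_scope.
Variables (R : realType) (Z : topologicalType).

(** The balls with centre in a dense set and radius 1/(n+1) are a basis; the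
    radius is chosen at most half of that of a ball around a inside U. *)
Lemma metric_balls (d : Z -> Z -> R) (E : set Z) :
  is_metric d -> metric_compatible d -> dense E ->
  forall (a : Z) (U : set Z), nbhs a U -> exists c n, [/\ E c,
    d c a < n.+1%:R^-1, nbhs a [set y | d c y < n.+1%:R^-1] &
    [set y | d c y < n.+1%:R^-1] `<=` U].
Proof.
move=> [d0 dI dC dT] dcomp dE a U /dcomp[r r0 rU].
have [n nr] : exists n : nat, n.+1%:R^-1 < r / 2.
  exists (Num.bound (r / 2)^-1).
  rewrite invf_plt ?posrE ?divr_gt0 //.
  apply: lt_trans (archi_boundP _) _; first by rewrite invr_ge0 divr_ge0 // ltW.
  by rewrite ltr_nat.
have nball : nbhs a [set y | d a y < n.+1%:R^-1].
  by apply/dcomp; exists n.+1%:R^-1; rewrite ?invr_gt0.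
have [O [oO Oa] ON] : exists2 O, open_nbhs a O & O `<=` [set y | d a y < n.+1%:R^-1].
  by move: nball; rewrite nbhsE.
have [c [Oc Ec]] := dE O (ex_intro _ a Oa) oO.
have ca : d c a < n.+1%:R^-1 by rewrite dC; exact: ON.
exists c, n; split=> //.
  apply/dcomp; exists (n.+1%:R^-1 - d c a); first by rewrite subr_gt0.
  by move=> y /= ay; apply: le_lt_trans (dT c a y) _; rewrite -ltrBrDl.
move=> y /= cy; apply: rU => /=; apply: le_lt_trans (dT a c y) _.
by rewrite dC (splitr r) ltrD // (lt_trans _ nr).
Qed.

(** For each pair of basic balls (V, V') choose a clopen set W between them, if
    there is one.  These W are countably many, and they form a basis: given a
    ball V' around a, some clopen W0 containing a is inside V', and some ball V
    around a is inside W0, so that W0 shows that a choice was possible for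
    (V, V').  The coordinates are the indicators of the sets W. *)
Lemma polish_coordinates : polish R Z -> has_clopen_basis Z ->
  exists e : Z -> nat -> bool, coordinates e.
Proof.
move=> [[E /countable_injP[code codeI] dE] [d [dm dc _]]] [_ clb].
have balls := metric_balls dm dc dE.
pose V (c n : nat) := [set y | exists x, [/\ E x, code x = c & d x y < n.+1%:R^-1]].
have VE x n : E x -> V (code x) n = [set y | d x y < n.+1%:R^-1].
  move=> Ex; apply/seteqP; split=> [y [x' [Ex' xx' x'y]]|y xy]; last by exists x.
  by rewrite /= -(codeI x' x) ?inE.
have {VE}balls (a : Z) (U : set Z) : nbhs a U ->
    exists c n, [/\ V c n a, nbhs a (V c n) & V c n `<=` U].
  by move=> /balls[x [n [Ex xa nx xU]]]; exists (code x), n; rewrite VE.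
pose sep (j : (nat * nat) * (nat * nat)) (W : set Z) :=
  V j.1.1 j.1.2 `<=` W /\ W `<=` V j.2.1 j.2.2.
have /choice[W WP] : forall j, exists W : set Z,
    clopen W /\ ((exists W', clopen W' /\ sep j W') -> sep j W).
  move=> j; have [[W [cW sW]]|no] := pselect (exists W', clopen W' /\ sep j W').
    by exists W.
  by exists set0; split=> //; split; [exact: open0|exact: closed0].
exists (fun a k => if choice.unpickle k is Some j then `[< W j a >] else false).
split=> [k|a U nU].
  case: (choice.unpickle k) => [j|]; last exact: lc_cst.
  by apply: clopen_lc; case: (WP j).
have [c [n [_ nV VU]]] := balls a U nU.
have [W0 [[cW0 W0a] W0V]] : exists W0, (clopen W0 /\ W0 a) /\ W0 `<=` V c n.
  by have [W0 ? ?] := clb a _ nV; exists W0.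
have [c' [n' [V'a _ V'W0]]] : exists c n, [/\ V c n a, nbhs a (V c n) & V c n `<=` W0].
  by apply: balls; apply: open_nbhs_nbhs; split=> //; case: cW0.
pose j := ((c', n'), (c, n)).
have [_ /(_ _)[|V'W WV]] := WP j; first by exists W0.
exists (choice.pickle j).+1 => b /mkseq_eqP /(_ _ (ltnSn _)).
rewrite choice.pickleK (asboolT (V'W _ V'a)) => /asboolP Wb.
exact/VU/WV.
Qed.

End PolishCoordinates.

(** * The set of codes of Ramsey positive analytic sets *)

(** The reduction sends a to its clopen coordinates, a point of the Cantor
    space, and then to a code of the section of the domination set there. *)
Theorem theorem1 (R : realType) (A : set (cantor_space * infset)) :
  good_universal_Sigma11 A ->
  Sigma12_complete R [set x : cantor_space | ramsey_positive (xsection A x)].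
Proof.
move=> [[C clC AC] _ good]; split.
  rewrite (_ : [set x | _] = [set x | ramsey_positive [set Y | exists z, C (x, Y, z)]]).
    exact: (Sigma12_positive coordinates_cantor clC).
  congr (fun F => [set x | ramsey_positive (F x)]); apply/funext => x.
  apply/seteqP; split=> Y; rewrite xsectionE AC.
    by move=> [[[x' Y'] z] Cz [<- <-]]; exists z.
  by move=> [z Cz]; exists (x, Y, z).
move=> Z pZ clZ P' [W [D clD WD] ->].
have [e cZ] := polish_coordinates pZ clZ.
have [h hcont hA] := good _ (Sigma11_domination_set e D).
exists (h \o (e : Z -> cantor_space)).
  move=> a; apply: continuous_comp; last exact: hcont.
  exact: (continuous_coordinates (g := e : Z -> cantor_space) coordinates_cantor cZ.1).
apply/seteqP; split=> a /=; rewrite -hA.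
  move=> /(domination_set_positive cZ clD)[z noD]; exists (a, z) => //=.
  apply: contrapT => nW; have : (~` W) (a, z) by [].
  by rewrite WD => -[[az p] Dp azE]; apply: (noD p); rewrite -azE.
move=> [[a' z] Wz <-]; apply/(domination_set_positive cZ clD); exists z => p Dp.
by have : (~` W) (a', z) by rewrite WD; exists (a', z, p).
Qed.
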